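(* There is a one-round proof labeling scheme for $\textsc{Permutation-Recognition}$ with certificates of size $\mathcal{O}(\log n)$; that is, a proof labeling scheme deciding whether the connected $n$-node network $G$ is a permutation graph, in which every certificate has $\mathcal{O}(\log n)$ bits.
   Context: A graph $G=([n],E)$ (with $[n]=\{0,\dots,n-1\}$) is a permutation graph if there exists a permutation $\pi$ of $[n]$ such that for all $i,j\in[n]$, $\{i,j\}\in E$ iff $(i-j)(\pi(i)-\pi(j))<0$; a general graph is a permutation graph if it is isomorphic to such a graph. $\textsc{Permutation-Recognition}$ is the set of configurations $\langle G,\mathrm{id}\rangle$ with $G$ a permutation graph. Distributed setting: $G$ is a simple connected $n$-node graph, each node has a unique identifier in $\{1,\dots,\mathrm{poly}(n)\}$, nodes know only a polynomial upper bound on $n$. A proof labeling scheme (one-round, $\mathsf{dM}$) consists of an untrusted prover assigning each node $v$ a certificate $c(v)$, followed by one deterministic verification round in which each node sees its own id and certificate and the certificates (and ids) of its neighbors and accepts or rejects. Completeness: if $G$ is in the class, some certificate assignment makes all nodes accept. Soundness: if $G$ is not in the class, for every certificate assignment at least one node rejects. Its size is the maximum certificate length in bits. *)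

(* Defs.v *)
From mathcomp Require Import all_boot all_order all_algebra all_fingroup.
Set Implicit Arguments. Unset Strict Implicit. Unset Printing Implicit Defensive.
Import Order.TTheory GRing.Theory Num.Theory.

Definition cert := bitseq.

Definition simple_graph n (adj : rel 'I_n) : Prop :=
  irreflexive adj /\ symmetric adj.
Definition connected_graph n (adj : rel 'I_n) : Prop :=
  forall u v, connect adj u v.

Definition perm_graph_of n (pi : {perm 'I_n}) : rel 'I_n :=
  fun i j => (((i : nat)%:Z - (j : nat)%:Z) *
              (((pi i : 'I_n) : nat)%:Z - ((pi j : 'I_n) : nat)%:Z) < 0)%R.

Definition is_permutation_graph n (adj : rel 'I_n) : Prop :=
  exists (sigma pi : {perm 'I_n}),
    forall u v, adj u v = perm_graph_of pi (sigma u) (sigma v).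

Definition valid_ids n (id : 'I_n -> nat) (bound : nat) : Prop :=
  injective id /\ forall v, 1 <= id v <= bound.

(* A verifier: given the known upper bound N on n, its own identifier,
   its own certificate, and the list of (identifier, certificate) of its
   neighbors (sorted by identifier, so no extra information is leaked),
   the node accepts (true) or rejects (false). *)
Definition verifier := nat -> nat -> cert -> seq (nat * cert) -> bool.

Definition neighbor_view n (adj : rel 'I_n) (id : 'I_n -> nat)
    (c : 'I_n -> cert) (v : 'I_n) : seq (nat * cert) :=
  sort (fun a b : nat * cert => a.1 <= b.1)
       [seq (id u, c u) | u <- enum 'I_n & adj v u].

Definition accepts_all (V : verifier) N n (adj : rel 'I_n) (id : 'I_n -> nat)
    (c : 'I_n -> cert) : bool :=
  [forall v, V N (id v) (c v) (neighbor_view adj id c v)].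

Definition PLS (P : forall n, rel 'I_n -> Prop) (k : nat) (sz : nat -> nat)
    (V : verifier) : Prop :=
  forall n (adj : rel 'I_n) (id : 'I_n -> nat) (N : nat),
    0 < n -> simple_graph adj -> connected_graph adj ->
    valid_ids id (n ^ k) -> n <= N <= n ^ k ->
    (P n adj -> exists c : 'I_n -> cert,
        (forall v, size (c v) <= sz n) /\ accepts_all V N adj id c)
    /\
    (~ P n adj -> forall c : 'I_n -> cert, ~~ accepts_all V N adj id c).

(* Main.v *)
Require Import Defs.
From mathcomp Require Import all_boot all_order all_algebra all_fingroup.
From mathcomp Require Import zify.

(** Each vertex [v] is told its positions [x v] and [y v] in the two orders of
    the model.  It checks that every neighbour crosses it and that
    [y v + #{neighbours u | x u < x v} = x v + #{neighbours u | x v < x u}].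
    If [x] and [y] are bijections onto [0, n), this identity also holds with
    "neighbours" replaced by "crossing vertices", so in the graph of the
    crossing non-edges, oriented by [x], in- and out-degrees agree; an acyclic
    finite graph with this property has no edges.

    That [x] is a bijection (and [y], by symmetry) follows once [n] is certified
    by subtree sizes in a spanning tree rooted at the vertex of rank [0], and
    every [i + 1 < n] is shown to be a rank whenever [i] is.  For the latter, let
    [p] maximise [y] among the vertices with [x <= i], and [q] minimise [y]
    among those with [x > i].  Then [p] is equal or adjacent to the vertex of
    rank [i], [q] to the vertex of rank [i + 1], and [p] and [q] are adjacent
    because the graph is connected.  The vertex of rank [i] only names [p].
    The vertex [q] announces an interval of ranks, containing [i + 1], all of
    which it sees, and [p] checks that some neighbour covers [i + 1] in this
    way; a fixed vertex [q] thereby serves all the [i] it is needed for. *)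

Set Implicit Arguments. Unset Strict Implicit. Unset Printing Implicit Defensive.

(** * Fixed-width binary certificates *)

Fixpoint nat_bits (L m : nat) : bitseq :=
  if L is L'.+1 then odd m :: nat_bits L' m./2 else [::].

Definition bits_nat (s : bitseq) : nat := foldr (fun (b : bool) m => b + m.*2) 0 s.

Lemma size_nat_bits L m : size (nat_bits L m) = L.
Proof. by elim: L m => //= L IHL m; rewrite IHL. Qed.

Lemma nat_bitsK L m : m < 2 ^ L -> bits_nat (nat_bits L m) = m.
Proof.
elim: L m => [|L IHL] m; first by case: m.
move=> ltm /=; rewrite -/(bits_nat _) IHL ?odd_double_half //.
by rewrite -ltn_double -[(2 ^ L).*2]mul2n -expnS; have := odd_double_half m; lia.
Qed.

Definition encode_nats L (s : seq nat) : bitseq := flatten [seq nat_bits L m | m <- s].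

Definition decode_nats L d (c : bitseq) : seq nat :=
  [seq bits_nat b | b <- reshape (nseq d L) c].

Lemma size_encode_nats L s : size (encode_nats L s) = size s * L.
Proof.
elim: s => //= m s IHs; rewrite /encode_nats /= size_cat size_nat_bits.
by rewrite -/(encode_nats L s) IHs mulSn.
Qed.

Lemma encode_natsK L s :
  all (fun m => m < 2 ^ L) s -> decode_nats L (size s) (encode_nats L s) = s.
Proof.
move=> /allP lts; rewrite /decode_nats /encode_nats.
have -> : nseq (size s) L = shape [seq nat_bits L m | m <- s].
  by elim: s {lts} => //= m s ->; rewrite size_nat_bits.
rewrite flattenK -map_comp -[RHS]map_id; apply/eq_in_map => m /lts.
exact: nat_bitsK.
Qed.

(* The data of a vertex [v] for one of the two orders.  With [x] the positions in
   this order and [y] those in the other one, an honest prover sets [rank] to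
   [x v], [peak] to the largest-[y] vertex among those with [x <= x v], given by
   its rank, and [low] to the least [s] such that [y v <= y z] whenever
   [s <= x z <= x v].  The other fields describe a spanning tree, [weight] being
   the size of the subtree at [v]. *)
Record label := Label {
  rank : nat; peak : nat; low : nat;
  root_id : nat; parent_id : nat; weight : nat; total : nat }.

Definition nats_of_label l :=
  [:: rank l; peak l; low l; root_id l; parent_id l; weight l; total l].

Definition label_of_nats s :=
  Label (nth 0 s 0) (nth 0 s 1) (nth 0 s 2) (nth 0 s 3)
        (nth 0 s 4) (nth 0 s 5) (nth 0 s 6).

Definition label_bounded B l := all (fun m => m < B) (nats_of_label l).

Definition encode L (l : label * label) : cert :=
  encode_nats L (nats_of_label l.1 ++ nats_of_label l.2).

(** Total on all bit strings: [reshape] cuts any input into 14 blocks, seven per label, so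
    adversarial certificates also yield two labels. *)
Definition decode L (c : cert) : label * label :=
  let s := decode_nats L 14 c in (label_of_nats (take 7 s), label_of_nats (drop 7 s)).

Lemma encodeK L l :
  label_bounded (2 ^ L) l.1 -> label_bounded (2 ^ L) l.2 -> decode L (encode L l) = l.
Proof.
case: l => [[x1 x2 x3 x4 x5 x6 x7] [y1 y2 y3 y4 y5 y6 y7]] lt1 lt2.
rewrite /decode /encode; set s := _ ++ _; have -> // : decode_nats L 14 (encode_nats L s) = s.
by rewrite -[14]/(size s) encode_natsK // all_cat; apply/andP.
Qed.

(* The verifier cannot use [n], so the field width is computed from [N]. *)
Definition width k N := k.+1 * (trunc_log 2 N).+1.

Lemma exp_lt_width k n N : n <= N -> n ^ k < 2 ^ width k N.
Proof.
move=> le_nN; rewrite /width mulnC expnM.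
have ltn2 : n < 2 ^ (trunc_log 2 N).+1 by apply: leq_ltn_trans le_nN (trunc_log_ltn _ _).
apply: (@leq_ltn_trans ((2 ^ (trunc_log 2 N).+1) ^ k)); last first.
  by rewrite ltn_exp2l // expnS; have := expn_gt0 2 (trunc_log 2 N); lia.
by case: k => // k; rewrite leq_exp2r // ltnW.
Qed.

(** Since [N] is polynomial in [n], its logarithm is at most [k] times that of [n], up to rounding;
    the other factor [k.+1] is already in [width]. *)
Lemma width_exp k n N : N <= n ^ k -> width k N <= k.+1 ^ 2 * (trunc_log 2 n).+1.
Proof.
move=> le_N; rewrite /width -mulnn -mulnA leq_mul2l /=.
have lt_n : n < 2 ^ (trunc_log 2 n).+1 by apply: trunc_log_ltn.
have le_log : trunc_log 2 N <= k * (trunc_log 2 n).+1.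
  case: (posnP N) => [->|N_gt0]; first by rewrite trunc_log0.
  rewrite -(@leq_exp2l 2) // mulnC expnM.
  apply: leq_trans (trunc_logP _ N_gt0) _ => //; apply: leq_trans le_N _.
  by case: k => // k; rewrite leq_exp2r // ltnW.
by rewrite mulSn; lia.
Qed.

(** * Crossing pairs and counting arguments *)

Definition crossing (T : Type) (x y : T -> nat) : rel T :=
  fun u v => (x u < x v) && (y v < y u) || (x v < x u) && (y u < y v).

Lemma crossing_sym (T : Type) (x y : T -> nat) : symmetric (crossing x y).
Proof. by move=> u v; rewrite /crossing orbC. Qed.

Lemma crossingC (T : Type) (x y : T -> nat) : crossing x y =2 crossing y x.
Proof. by move=> u v; rewrite /crossing orbC ![_ && (y _ < _)]andbC. Qed.

Lemma card_rank_lt (T : finType) (x : T -> nat) (v : T) :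
  injective x -> (forall u, x u < #|T|) -> #|[set u | x u < x v]| = x v.
Proof.
move=> x_inj x_lt; pose f u := Ordinal (x_lt u).
have f_inj : injective f by move=> u w [/x_inj].
have f_bij : bijective f by apply: inj_card_bij; rewrite ?card_ord.
have le_v : x v <= #|T| by apply: ltnW.
have widen_inj : injective (widen_ord le_v) by move=> i j [/val_inj].
transitivity #|[set: 'I_(x v)]|; last by rewrite cardsT card_ord.
rewrite -(card_imset _ f_inj) -(card_imset _ widen_inj).
apply: eq_card => i; apply/imsetP/imsetP => [[u] | [j _ ->]].
  rewrite inE => lt_u ->; exists (Ordinal lt_u) => //; exact: val_inj.
have [g _ fK] := f_bij; exists (g (widen_ord le_v j)); last by rewrite fK.
by rewrite inE -[x (g _)]/(val (f (g _))) fK /=.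
Qed.

Section Counting.
Variables (T : finType) (adj : rel T) (x y : T -> nat).
Hypothesis adj_sym : symmetric adj.
Hypotheses (x_inj : injective x) (y_inj : injective y).
Hypotheses (x_lt : forall u, x u < #|T|) (y_lt : forall u, y u < #|T|).

(** [x v] and [y v] count the vertices before [v] in each order. Vertices before [v] in both orders
    cancel, leaving the two kinds of crossing vertices. *)
Lemma crossing_balance v :
  y v + #|[set u | (x u < x v) && (y v < y u)]| =
  x v + #|[set u | (x v < x u) && (y u < y v)]|.
Proof.
have splits (f g : T -> nat) : injective g ->
    #|[set u | f u < f v]| = #|[set u | (f u < f v) && (g u < g v)]| +
                             #|[set u | (f u < f v) && (g v < g u)]|.
  move=> g_inj; rewrite -(cardsID [set u | g u < g v]); congr (_ + _).
    by apply: eq_card => u; rewrite !inE.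
  apply: eq_card => u; rewrite !inE -leqNgt leq_eqVlt andbC.
  by case: eqP => // /g_inj->; rewrite !ltnn.
have := splits x y y_inj; have := splits y x x_inj.
rewrite !card_rank_lt // => y_split x_split.
suff swap (f g : T -> nat) (P Q : rel nat) :
    #|[set u | P (f u) (f v) && Q (g u) (g v)]| =
    #|[set u | Q (g u) (g v) && P (f u) (f v)]|.
  have := swap x y ltn ltn; have := swap x y (fun m n => n < m) ltn.
  by rewrite /= => -> eq_lt; move: y_split x_split; rewrite eq_lt; lia.
by apply: eq_card => u; rewrite !inE andbC.
Qed.

(* Orient each crossing pair that is not an edge towards the larger [x].  By
   [crossing_balance] the in- and out-degrees of this acyclic orientation agree
   at every vertex, so there is no such pair. *)
Lemma adj_eq_crossing :
  (forall u v, adj u v -> crossing x y u v) ->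
  (forall v, y v + #|[set u | adj v u && (x u < x v)]| =
             x v + #|[set u | adj v u && (x v < x u)]|) ->
  adj =2 crossing x y.
Proof.
move=> adj_cross balance u v; apply/idP/idP; first exact: adj_cross.
suff before_adj m w z : x w < m -> x w < x z -> y z < y w -> adj w z.
  by case/orP=> /andP[? ?]; last rewrite adj_sym; apply: before_adj (ltnSn _) _ _.
elim: m w z => // m IHm w z lt_wm lt_x lt_y.
pose In := [set u | (x u < x w) && (y w < y u)].
pose Out := [set u | (x w < x u) && (y u < y w)].
pose AIn := [set u | adj w u && (x u < x w)].
pose AOut := [set u | adj w u && (x w < x u)].
(* Crossing vertices to the left of [w] are adjacent to it by induction on [x]. The two balance
   equations then give [Out] and its subset [AOut] the same size. *)
have InE : AIn = In.
  apply/setP=> t; rewrite !inE; apply/andP/andP => [[/adj_cross/orP] | [lt_tx lt_ty]].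
    by case=> /andP[]; lia.
  by rewrite adj_sym; split=> //; apply: IHm; lia.
have sOut : AOut \subset Out.
  by apply/subsetP=> t; rewrite !inE => /andP[/adj_cross/orP[]/andP[lt_x' lt_y'] lt_x''];
    apply/andP; split; lia.
have cardOut : #|Out| <= #|AOut|.
  have := crossing_balance w; have := balance w.
  by rewrite -/AIn -/AOut -/In -/Out InE => eq1 eq2; rewrite -(leq_add2l (x w)) -eq1 -eq2.
have /eqP OutE : AOut == Out by rewrite eqEcard sOut.
have : z \in AOut by rewrite OutE inE lt_x.
by rewrite inE => /andP[].
Qed.

End Counting.

(** In the sum of all the local equations each non-root weight occurs exactly once on the right,
    namely at its only parent, and cancels. *)
Lemma forest_weight (T : finType) (isroot : pred T) (child : rel T) (W : T -> nat) :
  (forall u, ~~ isroot u -> #|[pred v | child u v]| = 1) ->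
  (forall v, W v = 1 + \sum_(u | ~~ isroot u && child u v) W u) ->
  \sum_(v | isroot v) W v = #|T|.
Proof.
move=> one_parent WE; have: \sum_v W v = #|T| + \sum_(u | ~~ isroot u) W u.
  rewrite (eq_bigr _ (fun v _ => WE v)) big_split /= sum1_card; congr (_ + _).
  rewrite (exchange_big_dep (fun u => ~~ isroot u)) /=; last by move=> u v _ /andP[].
  apply: eq_bigr => u root'u; rewrite (eq_bigl [pred v | child u v]).
    by rewrite sum_nat_const one_parent ?mul1n.
  by move=> v; rewrite /= root'u.
by rewrite (bigID isroot) /=; lia.
Qed.

Lemma connected_const (T : finType) (adj : rel T) (A : Type) (f : T -> A) :
  (forall u v, connect adj u v) -> (forall u v, adj u v -> f u = f v) ->
  forall u v, f u = f v.
Proof.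
move=> conn f_adj u v; have /connectP[p adj_p ->] := conn u v.
by elim: p u adj_p => //= w p IHp u /andP[/f_adj-> /IHp].
Qed.

(** * Local verification of one order *)

Definition label_ok (i : nat) (l : label) (nb : seq (nat * label)) : bool :=
  let cl := (i, l) :: nb in
  [&& all (fun b => (root_id b.2 == root_id l) && (total b.2 == total l)) nb,
      (i == root_id l) ==> (rank l == 0) && (weight l == total l),
      (i != root_id l) ==> has (fun b => b.1 == parent_id l) nb,
      weight l == 1 + \sum_(b <- nb | (b.1 != root_id l) && (parent_id b.2 == i)) weight b.2,
      rank l < total l,
      all (fun t => (low l <= t) ==> has (fun b => rank b.2 == t) cl) (iota 0 (rank l).+1),
      has (fun b => rank b.2 == peak l) cl
    & all (fun b => (peak b.2 == rank l) ==> ((rank b.2).+1 == total l) ||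
                    has (fun q => low q.2 <= (rank b.2).+1 <= rank q.2) cl) cl].

(** The graph-side reading of [label_ok]. The root is never counted as a child in [weight_ok]. In
    [next_ok], [v] is the peak named by [u] and looks for a [q] covering the rank after that of
    [u]. *)
Record consistent (T : finType) (adj : rel T) (id : T -> nat) (a : T -> label) (v : T)
    : Prop := Consistent {
  same_root : forall u, adj v u -> root_id (a u) = root_id (a v);
  same_total : forall u, adj v u -> total (a u) = total (a v);
  root_ok : id v = root_id (a v) -> rank (a v) = 0 /\ weight (a v) = total (a v);
  parent_ok : id v != root_id (a v) -> exists2 u, adj v u & id u = parent_id (a v);
  weight_ok : weight (a v) = 1 +
    \sum_(u | adj v u && (id u != root_id (a v)) && (parent_id (a u) == id v)) weight (a u);
  rank_ok : rank (a v) < total (a v);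
  low_ok : forall t, low (a v) <= t <= rank (a v) ->
    exists2 u, (u == v) || adj v u & rank (a u) = t;
  peak_ok : exists2 u, (u == v) || adj v u & rank (a u) = peak (a v);
  next_ok : forall u, (u == v) || adj v u -> peak (a u) = rank (a v) ->
    (rank (a u)).+1 = total (a v) \/
    exists2 q, (q == v) || adj v q & low (a q) <= (rank (a u)).+1 <= rank (a q) }.

Lemma label_okP (T : finType) (adj : rel T) id a v (s : seq T) :
  uniq s -> s =i adj v ->
  reflect (consistent adj id a v) (label_ok (id v) (a v) [seq (id u, a u) | u <- s]).
Proof.
move=> s_uniq sE; have clE u : (u \in v :: s) = (u == v) || adj v u.
  by rewrite inE sE.
have hasP' (P : pred (nat * label)) : reflect (exists2 u, (u == v) || adj v u & P (id u, a u))
    (has P ((id v, a v) :: [seq (id u, a u) | u <- s])).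
  rewrite -[_ :: _]/[seq (id u, a u) | u <- v :: s] has_map.
  by apply: (iffP hasP) => -[u]; rewrite ?clE => *; exists u; rewrite ?clE.
have allP' (P : pred (nat * label)) : reflect (forall u, (u == v) || adj v u -> P (id u, a u))
    (all P ((id v, a v) :: [seq (id u, a u) | u <- s])).
  rewrite -[_ :: _]/[seq (id u, a u) | u <- v :: s] all_map.
  by apply: (iffP allP) => allP u; have := allP u; rewrite clE.
have sumE : \sum_(b <- [seq (id u, a u) | u <- s] |
               (b.1 != root_id (a v)) && (parent_id b.2 == id v)) weight b.2 =
    \sum_(u | adj v u && (id u != root_id (a v)) && (parent_id (a u) == id v)) weight (a u).
  rewrite big_map -big_filter big_uniq ?filter_uniq //=; apply: eq_bigl => u.
  by rewrite mem_filter sE andbC andbA.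
rewrite /label_ok sumE.
apply: (iffP and5P) => [[]|[]].
  rewrite !all_map => /allP same /implyP rootv /implyP parentv /eqP weightv.
  case/and4P=> rankv /allP lowv /hasP' [p near_p /eqP rank_p] /allP' nextv.
  split=> //.
  - by move=> u; rewrite -[adj v u]sE => /same/andP[/eqP].
  - by move=> u; rewrite -[adj v u]sE => /same/andP[_ /eqP].
  - by move/eqP/rootv/andP=> [/eqP ? /eqP].
  - by move/parentv; rewrite has_map => /hasP[u]; rewrite sE => ? /eqP; exists u.
  - move=> t /andP[le_t t_le]; have : t \in iota 0 (rank (a v)).+1.
      by rewrite mem_iota.
    by case/lowv/implyP/(_ le_t)/hasP' => u ? /eqP; exists u.
  - by exists p.
  move=> u /nextv/implyP/= next_u /eqP/next_u /orP[/eqP|/hasP'[q]]; first by left.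
  by right; exists q.
move=> same_r same_t rootv parentv weightv rankv lowv [p near_p rank_p] nextv.
split; last (apply/and4P; split=> //).
- by rewrite all_map; apply/allP=> u; rewrite sE /= => adj_u; rewrite same_r ?same_t ?eqxx.
- by apply/implyP=> /eqP/rootv[-> ->]; rewrite !eqxx.
- apply/implyP=> /parentv[u adj_u id_u]; rewrite has_map; apply/hasP; exists u; rewrite ?sE //.
  exact/eqP.
- exact/eqP.
- apply/allP=> t; rewrite mem_iota => t_le; apply/implyP=> le_t.
  have /lowv[u near_u rank_u] : low (a v) <= t <= rank (a v) by rewrite le_t.
  by apply/hasP'; exists u => //; apply/eqP.
- by apply/hasP'; exists p => //; apply/eqP.
apply/allP' => u near_u; apply/implyP=> /eqP/(nextv u near_u)[/eqP-> //|[q ? ?]].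
by apply/orP; right; apply/hasP'; exists q.
Qed.

(** * Soundness: locally consistent labels give a bijective ranking *)

Section Soundness.
Variables (T : finType) (adj : rel T) (id : T -> nat) (a : T -> label).
Hypotheses (adj_sym : symmetric adj) (conn : forall u v, connect adj u v).
Hypotheses (id_inj : injective id) (ok : forall v, consistent adj id a v).

(** Connectedness makes [root_id] and [total] constant. By [forest_weight] the root weights sum to
    [#|T|], so a root exists; injective identifiers make it unique, and its weight is [total]. *)
Lemma consistent_total v : total (a v) = #|T| /\ exists u, rank (a u) = 0.
Proof.
have rootE u w : root_id (a u) = root_id (a w).
  by apply: (connected_const (f := root_id \o a) conn) => {}u {}w /(same_root (ok u))/= ->.
have totalE u w : total (a u) = total (a w).
  by apply: (connected_const (f := total \o a) conn) => {}u {}w /(same_total (ok u))/= ->.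
pose r := root_id (a v); pose isroot u := id u == r.
pose child u w := adj w u && (parent_id (a u) == id w).
have one_parent u : ~~ isroot u -> #|[pred w | child u w]| = 1.
  rewrite /isroot /r (rootE v u) => /(parent_ok (ok u))[p adj_p id_p].
  rewrite -(card1 p); apply: eq_card => w; rewrite !inE /child -id_p.
  apply/andP/eqP => [[_ /eqP/id_inj-> //]|->].
  by rewrite adj_sym adj_p eqxx.
have weightE w : (weight \o a) w = 1 + \sum_(u | ~~ isroot u && child u w) (weight \o a) u.
  rewrite /= (weight_ok (ok w)); congr (_ + _); apply: eq_bigl => u.
  by rewrite /isroot /r (rootE v w) /child andbCA andbA.
have := forest_weight one_parent weightE; have [u /eqP id_u | no_root] := pickP isroot; last first.
  by rewrite big_pred0 // => /esym/(fintype0 v).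
have [|rank_u weight_u] := root_ok (ok u); first by rewrite id_u /r (rootE v u).
rewrite (big_pred1 u) => [|w]; last by rewrite /= /isroot -id_u (inj_eq id_inj).
by rewrite /= weight_u (totalE u v) => ->; split=> //; exists u.
Qed.

(** It suffices to reach every value below [#|T|], by induction from the root: a surjection between
    sets of equal size is injective. *)
Lemma consistent_rank : (forall v, rank (a v) < #|T|) /\ injective (rank \o a).
Proof.
have totalE v : total (a v) = #|T| by case: (consistent_total v).
have rank_lt v : rank (a v) < #|T| by rewrite -(totalE v) (rank_ok (ok v)).
split=> //; have onto i : i < #|T| -> exists v, rank (a v) = i.
  elim: i => [/card_gt0P[v _]|i IHi lt_i]; first by case: (consistent_total v).
  have [v rank_v] := IHi (ltnW lt_i).
  have [p near_p rank_p] := peak_ok (ok v).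
  (* As [v] names [p], the check at [p] supplies a [q] whose announced interval contains [i.+1], and
     [low_ok] at [q] turns this into a vertex. *)
  have near_v : (v == p) || adj p v by rewrite eq_sym adj_sym.
  case: (next_ok (ok p) near_v (esym rank_p)); rewrite rank_v; first by rewrite totalE; lia.
  by case=> q _ /(low_ok (ok q))[u _ ?]; exists u.
pose f v := Ordinal (rank_lt v).
suff: {in T &, injective f} by move=> f_inj u v eq_uv; apply: f_inj => //; apply: val_inj.
apply/image_injP; rewrite -[X in _ == X]card_ord; apply/eqP/eq_card => i.
by have [v rank_v] := onto i (ltn_ord i); apply/imageP; exists v => //; apply: val_inj.
Qed.

End Soundness.

(** * Completeness: spanning trees and honest labels *)

(** Take [d] to be the distance from [r]; the last vertex but one of a shortest path is a closer
    neighbour. *)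
Lemma rooted_tree (T : finType) (adj : rel T) (r : T) :
  symmetric adj -> (forall u v, connect adj u v) ->
  exists (par : T -> T) (d : T -> nat),
    forall v, v != r -> adj v (par v) && (d (par v) < d v).
Proof.
move=> adj_sym conn.
pose reach v k := [exists p : k.-tuple T, path adj r p && (last r p == v)].
have reachP v : exists k, reach v k.
  have /connectP[p adj_p ->] := conn r v; exists (size p); apply/existsP.
  by exists (in_tuple p); rewrite adj_p /=.
pose d v := ex_minn (reachP v).
have closer v : exists u, (v != r) ==> adj v u && (d u < d v).
  have [->|v'r /=] := eqVneq v r; first by exists r.
  rewrite {2}/d; case: ex_minnP => k /existsP[p /andP[adj_p /eqP last_p]] _.
  move: (size_tuple p) adj_p last_p; move: v'r; case/lastP: {p}(tval p) => [|p w].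
    by move=> /= + _ _ rv; rewrite rv eqxx.
  rewrite size_rcons rcons_path last_rcons => _ size_p /andP[adj_p adj_w] w_v.
  exists (last r p); rewrite -w_v adj_sym adj_w /= -size_p ltnS.
  rewrite /d; case: ex_minnP => m _; apply; apply/existsP.
  by exists (in_tuple p); rewrite adj_p /=.
exists (fun v => xchoose (closer v)), d => v v'r.
exact: (implyP (xchooseP (closer v))).
Qed.

(** Iterate the weight recursion from zero: children have larger [d], and [d] is bounded, so values
    stabilise from the leaves upwards. Weights increase towards the root, which gives the bound. *)
Lemma subtree_weights (T : finType) (r : T) (par : T -> T) (d : T -> nat) :
  (forall v, v != r -> d (par v) < d v) ->
  exists W : T -> nat,
    [/\ forall v, W v = 1 + \sum_(u | (u != r) && (par u == v)) W u,
        W r = #|T| & forall v, W v <= #|T|].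
Proof.
move=> d_par; pose step (W : T -> nat) v := 1 + \sum_(u | (u != r) && (par u == v)) W u.
have [D d_lt] : exists D, forall v, d v < D.
  by exists (\max_v d v).+1 => v; rewrite ltnS leq_bigmax.
have stable k v : D <= k + d v -> iter k.+1 step (fun=> 0) v = iter k step (fun=> 0) v.
  elim: k v => [|k IHk] v; first by rewrite leqNgt d_lt.
  move=> le_k; congr (1 + _); apply: eq_bigr => u /andP[u'r /eqP par_u].
  by apply: IHk; have := d_par u u'r; rewrite par_u; lia.
pose W := iter D step (fun=> 0).
have WE v : W v = 1 + \sum_(u | (u != r) && (par u == v)) W u.
  by rewrite /W -stable ?leq_addr.
have Wr : W r = #|T|.
  rewrite -(@forest_weight T (pred1 r) (fun u v => par u == v) W) ?big_pred1_eq //.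
  by move=> u _; rewrite -(card1 (par u)); apply: eq_card => v; rewrite !inE eq_sym.
exists W; split=> // v; rewrite -Wr; have [k] := ubnP (d v).
elim: k v => // k IHk v lt_k; have [->//|v'r] := eqVneq v r.
apply: leq_trans (IHk (par v) _); last by have := d_par v v'r; lia.
by rewrite (WE (par v)) (bigD1 v) /= ?v'r ?eqxx //; lia.
Qed.

Section Completeness.
Variables (T : finType) (adj : rel T) (id x y : T -> nat) (B : nat).
Hypotheses (conn : forall u v, connect adj u v) (id_inj : injective id).
Hypotheses (x_inj : injective x) (x_lt : forall u, x u < #|T|).
Hypothesis y_inj : injective y.
Hypothesis adjE : adj =2 crossing x y.
Hypotheses (T_lt : #|T| < B) (id_lt : forall v, id v < B).

Lemma rank_onto i : i < #|T| -> exists v, x v = i.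
Proof.
move=> lt_i; pose f u := Ordinal (x_lt u).
have [g _ fK] : bijective f.
  by apply: inj_card_bij; rewrite ?card_ord // => u w [/x_inj].
by exists (g (Ordinal lt_i)); rewrite -[x _]/(val (f _)) fK.
Qed.

(** Otherwise [y u <= y p <= y q <= y w] whenever [x u <= i < x w], so no edge leaves the vertices
    with [x <= i], against connectedness. *)
Lemma crossing_cut p q i :
  x p <= i < x q ->
  (forall u, x u <= i -> y u <= y p) -> (forall u, i < x u -> y q <= y u) -> y q < y p.
Proof.
case/andP=> le_p lt_q max_p min_q; rewrite ltnNge; apply/negP=> le_pq.
suff cut u w : adj u w -> (x u <= i) = (x w <= i).
  by have := connected_const conn cut p q; rewrite le_p leqNgt lt_q.
rewrite adjE => /orP[]/andP[lt_x lt_y]; apply/idP/idP => le_i.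
- by rewrite leqNgt; apply/negP=> /min_q; have := max_p u le_i; lia.
- lia.
- lia.
- by rewrite leqNgt; apply/negP=> /min_q; have := max_p w le_i; lia.
Qed.

Lemma near_crossing u v :
  (x u <= x v) && (y v <= y u) || (x v <= x u) && (y u <= y v) -> (u == v) || adj v u.
Proof.
case: eqVneq => //= u'v; rewrite adjE /crossing.
have : x u != x v by rewrite (inj_eq x_inj).
have : y u != y v by rewrite (inj_eq y_inj).
lia.
Qed.

Lemma consistent_labels :
  exists a : T -> label,
    [/\ forall v, rank (a v) = x v, forall v, consistent adj id a v
      & forall v, label_bounded B (a v)].
Proof.
have adj_sym : symmetric adj by move=> u v; rewrite !adjE crossing_sym.
have [T0|/card_gt0P[v0 _]] := posnP #|T|.
  by exists (fun=> Label 0 0 0 0 0 0 0); split=> v; case: (fintype0 v T0).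
have T_gt0 : 0 < #|T| by apply/card_gt0P; exists v0.
(* The root must have rank 0, so each of the two orders gets its own tree. *)
have [r x_r] := rank_onto T_gt0.
have [par [d par_d]] := rooted_tree r adj_sym conn.
have adj_par v : v != r -> adj v (par v) by case/par_d/andP.
have d_par v : v != r -> d (par v) < d v by case/par_d/andP.
have [W [WE W_r W_le]] := subtree_weights d_par.
pose top v := [arg max_(p > v | x p <= x v) y p].
have topP v : x (top v) <= x v /\ forall u, x u <= x v -> y u <= y (top v).
  by rewrite /top; case: arg_maxnP.
pose visible v s := [forall z, (s <= x z <= x v) ==> (y v <= y z)].
have visible_ex v : exists s, visible v s.
  (* From [(x v).+1] on the interval is empty; the same witness later bounds [low] by [#|T|]. *)
  by exists (x v).+1; apply/forallP=> z; apply/implyP; lia.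
pose lowest v := ex_minn (visible_ex v).
have lowest_le v s : (forall z, s <= x z <= x v -> y v <= y z) -> lowest v <= s.
  rewrite /lowest; case: ex_minnP => m _ min_m vis; apply: min_m.
  by apply/forallP=> z; apply/implyP/vis.
have lowestP v z : lowest v <= x z <= x v -> y v <= y z.
  by rewrite /lowest; case: ex_minnP => m /forallP/(_ z)/implyP.
exists (fun v => Label (x v) (x (top v)) (lowest v) (id r) (id (par v)) (W v) #|T|).
split=> // v.
  split=> //=.
  - by move/id_inj->; rewrite x_r W_r.
  - by rewrite (inj_eq id_inj) => /adj_par; exists (par v).
  - rewrite {1}WE; congr (_ + _); apply: eq_bigl => u.
    rewrite !(inj_eq id_inj) andbAC; have [_|u'r] := eqVneq u r; rewrite /= ?andbF ?andbT //.
    by case: eqP => [<-|]; rewrite ?andbF // adj_sym adj_par.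
  - move=> t /andP[le_t t_le]; have [z x_z] := rank_onto (leq_ltn_trans t_le (x_lt v)).
    exists z => //; apply: near_crossing; rewrite x_z t_le /= lowestP ?orbT //.
      by rewrite x_z le_t.
  - exists (top v) => //; have [le_x max_y] := topP v.
    by apply: near_crossing; rewrite le_x max_y.
  move=> u near_u /x_inj top_u; rewrite -top_u in near_u *.
  have [le_x max_y] := topP u.
  have [lt_u|le_u] := ltnP (x u).+1 #|T|; last by left; apply/eqP; rewrite eqn_leq x_lt.
  right; have [z x_z] := rank_onto lt_u.
  have [q lt_q min_q] : exists2 q, x u < x q & forall w, x u < x w -> y q <= y w.
    have lt_z : x u < x z by rewrite x_z.
    by exists [arg min_(q < z | x u < x q) y q]; case: arg_minnP.
  have lt_y : y q < y (top u) by apply: (crossing_cut (i := x u)) => //; rewrite le_x.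
  (* [q] minimises [y] among all ranks above [x u], so its interval reaches down to [(x u).+1]. *)
  exists q; last by rewrite lt_q lowest_le // => w /andP[? _]; apply: min_q.
  by rewrite adjE /crossing (leq_ltn_trans le_x lt_q) lt_y /= orbT.
rewrite /label_bounded /= !id_lt T_lt !(ltn_trans (x_lt _) T_lt) /= !(leq_ltn_trans (W_le v) T_lt).
rewrite !andbT (leq_ltn_trans _ T_lt) //; apply: leq_trans (x_lt v).
by apply: lowest_le => z; lia.
Qed.
End Completeness.

(** * Permutation models and the full verifier *)

Lemma perm_graph_crossing n (pi : {perm 'I_n}) i j :
  perm_graph_of pi i j = crossing val (val \o pi) i j.
Proof.
rewrite /perm_graph_of /crossing /=; apply/idP/idP; last by nia.
case: (ltngtP i j) => [lt_ij|lt_ji|->]; nia.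
Qed.

(** Here [x] is [sigma] and [y] is [pi] after [sigma]. Conversely [pi] is [y] after the inverse of
    [x]; products of permutations apply the left factor first. *)
Lemma permutation_graphP n (adj : rel 'I_n) :
  is_permutation_graph adj <->
  exists x y : 'I_n -> nat,
    [/\ injective x, forall u, x u < n, injective y, forall u, y u < n
      & adj =2 crossing x y].
Proof.
split=> [[sigma [pi adjE]] | [x [y [x_inj x_lt y_inj y_lt adjE]]]].
  exists (val \o sigma), (val \o (pi \o sigma)); split=> //= u v; try by move/val_inj/perm_inj.
    by move/val_inj/perm_inj/perm_inj.
  by rewrite adjE perm_graph_crossing.
have f_inj : injective (fun u => Ordinal (x_lt u)) by move=> u v [/x_inj].
have g_inj : injective (fun u => Ordinal (y_lt u)) by move=> u v [/y_inj].
exists (perm f_inj), ((perm f_inj)^-1 * perm g_inj)%g => u v.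
by rewrite perm_graph_crossing /crossing /= !permM !permK !permE /= adjE.
Qed.

Lemma neighbor_viewE n (adj : rel 'I_n) id c v :
  exists s, [/\ uniq s, s =i adj v &
    neighbor_view adj id c v = [seq (id u, c u) | u <- s]].
Proof.
rewrite /neighbor_view sort_map; set s := sort _ _; exists s; split=> //.
  by rewrite sort_uniq filter_uniq ?enum_uniq.
by move=> u; rewrite mem_sort mem_filter mem_enum andbT.
Qed.

Definition crossing_ok (l : label * label) (nb : seq (nat * (label * label))) : bool :=
  all (fun b => crossing (fun l => rank l.1) (fun l => rank l.2) l b.2) nb &&
  (rank l.2 + count (fun b => rank b.2.1 < rank l.1) nb ==
   rank l.1 + count (fun b => rank l.1 < rank b.2.1) nb).

Definition permutation_verifier (k : nat) : verifier := fun N i c view =>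
  let l := decode (width k N) c in
  let nb := [seq (b.1, decode (width k N) b.2) | b <- view] in
  [&& label_ok i l.1 [seq (b.1, b.2.1) | b <- nb],
      label_ok i l.2 [seq (b.1, b.2.2) | b <- nb] & crossing_ok l nb].

(** Serves both directions: [a1] and [a2] are the honest labels for completeness, and the components
    of whatever the certificates decode to for soundness. *)
Lemma accepts_allP k N n (adj : rel 'I_n) id (c : 'I_n -> cert) (a1 a2 : 'I_n -> label)
    (x := rank \o a1) (y := rank \o a2) :
  (forall v, decode (width k N) (c v) = (a1 v, a2 v)) ->
  accepts_all (permutation_verifier k) N adj id c <->
  [/\ forall v, consistent adj id a1 v, forall v, consistent adj id a2 v,
      forall u v, adj u v -> crossing x y u v
    & forall v, y v + #|[set u | adj v u && (x u < x v)]| =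
                x v + #|[set u | adj v u && (x v < x u)]|].
Proof.
move=> cK.
have nodeP v : permutation_verifier k N (id v) (c v) (neighbor_view adj id c v) <->
    [/\ consistent adj id a1 v, consistent adj id a2 v,
        forall u, adj v u -> crossing x y v u
      & y v + #|[set u | adj v u && (x u < x v)]| =
        x v + #|[set u | adj v u && (x v < x u)]|].
  have [s [s_uniq sE ->]] := neighbor_viewE adj id c v.
  have countE (P : pred 'I_n) : count P s = #|[set u | adj v u && P u]|.
    rewrite -size_filter -(card_uniqP _) ?filter_uniq //.
    by apply: eq_card => u; rewrite inE mem_filter sE andbC.
  have viewE : [seq (b.1, decode (width k N) b.2) | b <- [seq (id u, c u) | u <- s]] =
      [seq (id u, (a1 u, a2 u)) | u <- s].
    by rewrite -map_comp; apply: eq_map => u /=; rewrite cK.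
  rewrite /permutation_verifier /crossing_ok cK viewE -!map_comp all_map !count_map !countE.
  split=> [/and3P[ok1 ok2 /andP[/allP cross /eqP bal]]|[ok1 ok2 cross bal]].
    split=> //; [exact/(label_okP _ _ s_uniq sE) | exact/(label_okP _ _ s_uniq sE) |].
    by move=> u; rewrite -[adj v u]sE => /cross.
  apply/and3P; split; [exact/(label_okP _ _ s_uniq sE) | exact/(label_okP _ _ s_uniq sE) |].
  by apply/andP; split; [apply/allP=> u; rewrite sE => /cross | apply/eqP].
split=> [/forallP ok|[ok1 ok2 cross bal]]; last first.
  by apply/forallP=> v; apply/nodeP; split=> // u; apply: cross.
by split=> [v|v|v u|v]; have /nodeP[] := ok v; auto.
Qed.

(* For every polynomial bound n^k on the identifiers (and on the known upper
   bound on n), there is a one-round proof labeling scheme for permutation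
   graph recognition with certificates of size O(log n). *)
Theorem theorem1 :
  forall k : nat, exists (C : nat) (V : verifier),
    PLS (@is_permutation_graph) k (fun n => C * (trunc_log 2 n).+1) V.
Proof.
(* Fourteen fields, each of the width bounded in [width_exp]. *)
move=> k; exists (14 * k.+1 ^ 2), (permutation_verifier k).
move=> n adj id N n_gt0 [_ adj_sym] conn [id_inj id_le] /andP[le_nN le_N]; split.
  case/permutation_graphP=> x [y [x_inj x_lt y_inj y_lt adjE]].
  have lt_B := exp_lt_width k le_nN; set L := width k N in lt_B.
  have n_lt : #|'I_n| < 2 ^ L by rewrite card_ord; lia.
  have id_lt v : id v < 2 ^ L by have := id_le v; lia.
  have labels z t : injective z -> (forall u, z u < n) -> injective t ->
      adj =2 crossing z t -> exists a : 'I_n -> label,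
    [/\ forall v, rank (a v) = z v, forall v, consistent adj id a v
      & forall v, label_bounded (2 ^ L) (a v)].
    move=> z_inj z_lt t_inj zt; apply: consistent_labels zt n_lt id_lt => // u.
    by rewrite card_ord.
  have [a1 [rank1 ok1 lt1]] := labels x y x_inj x_lt y_inj adjE.
  have [|a2 [rank2 ok2 lt2]] := labels y x y_inj y_lt x_inj.
    by move=> u v; rewrite adjE crossingC.
  pose c v := encode L (a1 v, a2 v).
  have cK v : decode L (c v) = (a1 v, a2 v).
    exact: (encodeK (l := (a1 v, a2 v)) (lt1 v) (lt2 v)).
  exists c; split=> [v|].
    rewrite /c /encode size_encode_nats size_cat /= -mulnA leq_mul2l /=.
    exact: width_exp.
  apply/(accepts_allP _ _ cK); split=> // [u v|v]; first by rewrite adjE /crossing /= !rank1 !rank2.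
  have x_lt' u : x u < #|'I_n| by rewrite card_ord.
  have y_lt' u : y u < #|'I_n| by rewrite card_ord.
  have := crossing_balance x_inj y_inj x_lt' y_lt' v.
  rewrite /= rank1 rank2.
  have -> : [set u | (x u < x v) && (y v < y u)] = [set u | adj v u && (rank (a1 u) < x v)].
    by apply/setP=> u; rewrite !inE adjE /crossing rank1; lia.
  have -> : [set u | (x v < x u) && (y u < y v)] = [set u | adj v u && (x v < rank (a1 u))].
    by apply/setP=> u; rewrite !inE adjE /crossing rank1; lia.
  by [].
move=> not_perm c.
have cK v := surjective_pairing (decode (width k N) (c v)).
apply/negP=> /(accepts_allP _ _ cK)[ok1 ok2 cross balance]; apply: not_perm.
have [x_lt x_inj] := consistent_rank adj_sym conn id_inj ok1.
have [y_lt y_inj] := consistent_rank adj_sym conn id_inj ok2.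
have adjE := adj_eq_crossing adj_sym x_inj y_inj x_lt y_lt cross balance.
rewrite card_ord in x_lt y_lt.
apply/permutation_graphP.
by exists (rank \o (fun v => (decode (width k N) (c v)).1)),
          (rank \o (fun v => (decode (width k N) (c v)).2)).
Qed.
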